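(* If $\mathscr V$ is a variety of algebras with a weak difference term but which is not congruence meet semidistributive, then $\mathscr K_\infty\subseteq\mathbf S\,\mathbf{Con}(\mathscr V)$.
   Context: $\mathbf{Con}(\mathscr V)=\{\mathbf{Con}(\mathbf A):\mathbf A\in\mathscr V\}$, and for a class $\mathscr X$ of algebras $\mathbf S\,\mathbf{Con}(\mathscr X)$ is the class of all lattices isomorphic to a sublattice of $\mathbf{Con}(\mathbf A)$ for some $\mathbf A\in\mathscr X$. For $p$ a prime or $0$, $\mathscr M_p^{\mathrm{fd}}$ is the class of all finite dimensional vector spaces over the prime field of characteristic $p$ (for a vector space, the congruence lattice is isomorphic to the lattice of subspaces). Define $$\mathscr K_\infty=\bigcap_{p\text{ a prime or }0}\mathbf S\,\mathbf{Con}(\mathscr M_p^{\mathrm{fd}}),$$ i.e. the class of all modular lattices that, for each $p$ a prime or $0$, can be embedded into the lattice of subspaces of some finite dimensional vector space over the prime field of characteristic $p$. $\mathscr V$ is congruence meet semidistributive if every $\mathbf{Con}(\mathbf A)$, $\mathbf A\in\mathscr V$, satisfies $x\wedge y=x\wedge z\rightarrow x\wedge y=x\wedge(y\vee z)$. Commutator: for congruences $\alpha,\beta,\delta$ of $\mathbf A$, $\mathrm C(\alpha,\beta;\delta)$ means that for every term $t(\bar x,\bar y)$ and all tuples $\bar a,\bar b,\bar c,\bar d$ from $A$ with $a_i\mathrel\alpha b_i$ and $c_j\mathrel\beta d_j$ for all $i,j$: if $t(\bar a,\bar c)\mathrel\delta t(\bar a,\bar d)$ then $t(\bar b,\bar c)\mathrel\delta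 t(\bar b,\bar d)$. The commutator $[\alpha,\beta]$ is the least $\delta$ with $\mathrm C(\alpha,\beta;\delta)$. A term $d(x,y,z)$ is a weak difference term for $\mathbf A$ if for all $\theta\in\mathbf{Con}(\mathbf A)$ and all $\langle a,b\rangle\in\theta$, $a\mathrel{[\theta,\theta]}d(a,b,b)$ and $d(a,a,b)\mathrel{[\theta,\theta]}b$. A variety has a weak difference term if some term $d$ is a weak difference term for all of its members. *)

(* Defs.v *)
From HB Require Import structures.
From mathcomp Require Import all_boot all_order all_algebra.
From mathcomp Require Import boolp.

Set Implicit Arguments.
Unset Strict Implicit.
Unset Printing Implicit Defensive.

Import Order.LTheory.
Local Open Scope order_scope.

(* Finitary signatures; symbols of arity 0 are allowed. *)
Record signature := Signature { symbol : Type; arity : symbol -> nat }.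

(* Algebras have nonempty universes. *)
Record algebra (S : signature) := Algebra {
  carrier :> Type;
  op : forall f : symbol S, ('I_(arity f) -> carrier) -> carrier;
  carrier_inhabited : inhabited carrier }.

Inductive term (S : signature) (X : Type) :=
  | Var of X
  | App (f : symbol S) of 'I_(arity f) -> term S X.

Fixpoint eval (S : signature) (X : Type) (A : algebra S) (v : X -> A)
    (t : term S X) : A :=
  match t with
  | Var x => v x
  | App f ts => op (fun i => eval v (ts i))
  end.

Definition satisfies (S : signature) (A : algebra S) (s t : term S nat) : Prop :=
  forall v : nat -> A, eval v s = eval v t.

Definition is_variety (S : signature) (V : algebra S -> Prop) : Prop :=
  exists E : term S nat -> term S nat -> Prop,
    forall A : algebra S, V A <-> (forall s t, E s t -> satisfies A s t).

Record congruence (S : signature) (A : algebra S) := Congruence {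
  crel :> A -> A -> Prop;
  crel_refl : forall a, crel a a;
  crel_sym : forall a b, crel a b -> crel b a;
  crel_trans : forall a b c, crel a b -> crel b c -> crel a c;
  crel_op : forall (f : symbol S) (a b : 'I_(arity f) -> A),
    (forall i, crel (a i) (b i)) -> crel (op a) (op b) }.

Section CongruenceLattice.
Variables (S : signature) (A : algebra S).

Lemma congruence_ext (x y : congruence A) :
  (forall a b, x a b <-> y a b) -> x = y.
Proof.
case: x => r r1 r2 r3 r4; case: y => s s1 s2 s3 s4 /= rs.
have E : r = s by apply/funext => a; apply/funext => b; apply/propext.
rewrite -{s}E in s1 s2 s3 s4 rs *.
by congr Congruence; apply: Prop_irrelevance.
Qed.

Definition cong_inf (P : congruence A -> Prop) : congruence A.
Proof.
exists (fun a b => forall x : congruence A, P x -> x a b).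
- by move=> a x _; apply: crel_refl.
- by move=> a b H x Px; apply: crel_sym; apply: H.
- by move=> a b c H K x Px; apply: crel_trans (H x Px) (K x Px).
- by move=> f a b H x Px; apply: crel_op => i; apply: H.
Defined.

Definition cong_le (x y : congruence A) : bool :=
  `[< forall a b, x a b -> y a b >].

Definition cong_meet (x y : congruence A) : congruence A :=
  cong_inf (fun z => z = x \/ z = y).

Definition cong_join (x y : congruence A) : congruence A :=
  cong_inf (fun z => cong_le x z /\ cong_le y z).

Lemma cong_meetE (x y : congruence A) a b :
  cong_meet x y a b <-> x a b /\ y a b.
Proof.
split=> [H|[xab yab] z [->|->]//].
by split; apply: H; [left|right].
Qed.

Fact cong_le_refl : reflexive cong_le.
Proof. by move=> x; apply/asboolP. Qed.

Fact cong_le_anti : antisymmetric cong_le.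
Proof.
move=> x y /andP[/asboolP xy /asboolP yx].
by apply: congruence_ext => a b; split; [apply: xy | apply: yx].
Qed.

Fact cong_le_trans : transitive cong_le.
Proof.
move=> y x z /asboolP xy /asboolP yz.
by apply/asboolP => a b /xy /yz.
Qed.

Fact cong_meetP x y z :
  cong_le x (cong_meet y z) = cong_le x y && cong_le x z.
Proof.
apply/idP/andP => [/asboolP H|[/asboolP H /asboolP K]].
  by split; apply/asboolP => a b /H /cong_meetE[].
by apply/asboolP => a b xab; apply/cong_meetE; split; [apply: H|apply: K].
Qed.

Fact cong_joinP x y z :
  cong_le (cong_join x y) z = cong_le x z && cong_le y z.
Proof.
apply/idP/andP => [/asboolP H|[xz yz]].
  split; apply/asboolP => a b xab; apply: H => w [/asboolP xw /asboolP yw];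
    by [apply: xw | apply: yw].
by apply/asboolP => a b; apply.
Qed.

Fact cong_display : Order.disp_t. Proof. exact: Order.Disp tt tt. Qed.

HB.instance Definition _ := gen_eqMixin (congruence A).
HB.instance Definition _ := gen_choiceMixin (congruence A).
HB.instance Definition _ := Order.Le_isPOrder.Build cong_display
  (congruence A) cong_le_refl cong_le_anti cong_le_trans.
HB.instance Definition _ := Order.POrder_MeetJoin_isLattice.Build cong_display
  (congruence A) cong_meetP cong_joinP.

End CongruenceLattice.

(* "L is isomorphic to a sublattice of Con(A)" is rendered by an injective
   map that preserves meets and joins. *)
Definition SCon (S : signature) (X : algebra S -> Prop)
    (d : Order.disp_t) (L : latticeType d) : Prop :=
  exists2 A : algebra S, X A &
    exists f : L -> congruence A,
      [/\ injective f,
          {morph f : x y / x `&` y} &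
          {morph f : x y / x `|` y}].

Definition meet_semidistributive (S : signature) (V : algebra S -> Prop) : Prop :=
  forall A : algebra S, V A -> forall x y z : congruence A,
    x `&` y = x `&` z -> x `&` y = x `&` (y `|` z).

Definition join_env (I J T : Type) (a : I -> T) (c : J -> T) (k : I + J) : T :=
  match k with inl i => a i | inr j => c j end.

Definition centralizes (S : signature) (A : algebra S)
    (alpha beta delta : congruence A) : Prop :=
  forall (m n : nat) (t : term S ('I_m + 'I_n))
         (a b : 'I_m -> A) (c d : 'I_n -> A),
    (forall i, alpha (a i) (b i)) -> (forall j, beta (c j) (d j)) ->
    delta (eval (join_env a c) t) (eval (join_env a d) t) ->
    delta (eval (join_env b c) t) (eval (join_env b d) t).

Definition commutator (S : signature) (A : algebra S)
    (alpha beta : congruence A) : congruence A :=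
  cong_inf (centralizes alpha beta).

Lemma commutator_least (S : signature) (A : algebra S)
    (alpha beta : congruence A) :
  centralizes alpha beta (commutator alpha beta) /\
  forall delta, centralizes alpha beta delta -> commutator alpha beta <= delta.
Proof.
split=> [m n t a b c d ab cd H delta Cdelta|delta Cdelta].
  exact: (Cdelta _ _ t a b c d ab cd (H _ Cdelta)).
by apply/asboolP => a b; apply.
Qed.

Definition is_weak_difference_term (S : signature) (A : algebra S)
    (d : term S 'I_3) : Prop :=
  let d3 a b c := eval (tnth [tuple a; b; c]) d : A in
  forall (theta : congruence A) (a b : A), theta a b ->
    commutator theta theta a (d3 a b b) /\
    commutator theta theta (d3 a a b) b.

Definition has_weak_difference_term (S : signature) (V : algebra S -> Prop) : Prop :=
  exists d : term S 'I_3, forall A : algebra S, V A -> is_weak_difference_term A d.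

Section VectorSpaces.
Local Open Scope ring_scope.

Inductive vs_symbol (F : Type) :=
  | VSzero
  | VSopp
  | VSadd
  | VSscale of F.

Definition vs_arity (F : Type) (f : vs_symbol F) : nat :=
  match f with VSzero => 0 | VSopp => 1 | VSadd => 2 | VSscale _ => 1 end%N.

Definition vs_signature (F : Type) : signature := Signature (@vs_arity F).

Definition vs_op (F : fieldType) (W : vectType F) (f : vs_symbol F) :
    ('I_(vs_arity f) -> W) -> W :=
  match f return ('I_(vs_arity f) -> W) -> W with
  | VSzero => fun _ => 0
  | VSopp => fun u => - u ord0
  | VSadd => fun u => u ord0 + u ord_max
  | VSscale a => fun u => a *: u ord0
  end.

Definition vs_algebra (F : fieldType) (W : vectType F) : algebra (vs_signature F) :=
  @Algebra (vs_signature F) W (@vs_op F W) (inhabits 0).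

(* vectType is the library notion of finite dimensional vector space. *)
Definition fd_vector_spaces (F : fieldType) (B : algebra (vs_signature F)) : Prop :=
  exists W : vectType F, B = vs_algebra W.

End VectorSpaces.

(* The prime fields are rat (characteristic 0) and 'F_p (p a prime). *)
Definition K_infty (d : Order.disp_t) (L : latticeType d) : Prop :=
  SCon (@fd_vector_spaces rat) L /\
  forall p : nat, prime p -> SCon (@fd_vector_spaces 'F_p) L.

(* Main.v *)
(* If x /\ y = x /\ z = delta < alpha = x /\ (y \/ z), then alpha is abelian
   modulo delta, because y and z, hence y \/ z, centralize x modulo delta.
   Modulo delta the weak difference term is then x - y + z for abelian groups on the
   alpha-blocks, and all terms are affine maps between blocks. After one more
   quotient if some n alpha is smaller than alpha, there is an injective affine
   map phi from a prime field F to a block: either some block has torsion, or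
   the blocks are torsion-free and divisible. For a vector space W over F, the
   affine maps from the dual W* to the alpha-blocks form a subalgebra of a power
   of A, and a subspace U of W is sent to the congruence "f and g agree on the
   annihilator of U". This is a lattice embedding; phi composed with evaluation
   at vectors of W shows that it is injective. *)

From HB Require Import structures.
Require Import Defs.
From mathcomp Require Import all_boot all_order all_algebra.
From mathcomp Require Import boolp.

Set Implicit Arguments.
Unset Strict Implicit.
Unset Printing Implicit Defensive.

Import Order.LTheory GRing.Theory Num.Theory.

(** * Substitution and evaluation of terms *)

Section Terms.
Variable S : signature.

Fixpoint subst (X Y : Type) (s : X -> term S Y) (t : term S X) : term S Y :=
  match t with
  | Var x => s x
  | App f ts => App (fun i => subst s (ts i))
  end.

Lemma eval_subst (A : algebra S) (X Y : Type) (v : Y -> A)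
    (s : X -> term S Y) (t : term S X) :
  eval v (subst s t) = eval (fun x => eval v (s x)) t.
Proof. by elim: t => //= f ts IH; congr op; apply/funext. Qed.

Lemma eval_hom (A B : algebra S) (h : A -> B)
    (hop : forall f (a : 'I_(arity f) -> A), h (op a) = op (h \o a))
    (X : Type) (v : X -> A) (t : term S X) :
  h (eval v t) = eval (h \o v) t.
Proof. by elim: t => //= f ts IH; rewrite hop; congr op; apply/funext. Qed.

Lemma crel_eval (A : algebra S) (x : congruence A) (X : Type) (v w : X -> A)
    (t : term S X) :
  (forall i, x (v i) (w i)) -> x (eval v t) (eval w t).
Proof. by move=> vw; elim: t => //= f ts IH; apply: crel_op. Qed.

Definition apply3 (A : algebra S) (d : term S 'I_3) (a b c : A) : A :=
  eval (tnth [tuple a; b; c]) d.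

Lemma eval_apply3 (A : algebra S) (d : term S 'I_3) (v : 'I_3 -> A) :
  eval v d = apply3 d (v ord0) (v (inord 1)) (v ord_max).
Proof.
rewrite /apply3; congr eval; apply/funext => i.
case: i => [[|[|[|//]]] Hi] /=; congr v; apply/val_inj => //=.
by rewrite inordK.
Qed.

Lemma apply3_hom (A B : algebra S) (h : A -> B)
    (hop : forall f (a : 'I_(arity f) -> A), h (op a) = op (h \o a))
    (d : term S 'I_3) (a b c : A) :
  h (apply3 d a b c) = apply3 d (h a) (h b) (h c).
Proof.
by rewrite [LHS](eval_hom hop) eval_apply3 /= !(tnth_nth a) /= inordK.
Qed.

Lemma crel_apply3 (A : algebra S) (x : congruence A) (d : term S 'I_3)
    (a b c a' b' c' : A) :
  x a a' -> x b b' -> x c c' -> x (apply3 d a b c) (apply3 d a' b' c').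
Proof.
move=> aa bb cc; apply: crel_eval => -[[|[|[|//]]] Hi] /=;
  by rewrite !(tnth_nth a).
Qed.

End Terms.

(** * The term condition and centralizers *)

Section Centralizer.
Variables (S : signature) (A : algebra S).
Implicit Types (x y z alpha beta delta : congruence A).

(** Each variable moves in only one of the two directions of the square, so sorting the variables by
    direction gives an instance of the term condition. *)
Lemma centralizes_square alpha beta delta (X : finType) (t : term S X)
    (v00 v01 v10 v11 : X -> A) :
  centralizes alpha beta delta ->
  (forall i, [/\ v00 i = v01 i, v10 i = v11 i & alpha (v00 i) (v10 i)] \/
             [/\ v00 i = v10 i, v01 i = v11 i & beta (v00 i) (v01 i)]) ->
  delta (eval v00 t) (eval v01 t) -> delta (eval v10 t) (eval v11 t).
Proof.
move=> C sq.
pose p i := `[< [/\ v00 i = v01 i, v10 i = v11 i & alpha (v00 i) (v10 i)] >].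
pose s i : term S ('I_#|X| + 'I_#|X|) :=
  Var _ (if p i then inl (enum_rank i) else inr (enum_rank i)).
(* Both groups get [#|X|] places; a place whose variable belongs to the other group is held at its
   value in [v00]. *)
pose g (v : X -> A) (b : bool) (j : 'I_#|X|) :=
  if p (enum_val j) == b then v (enum_val j) else v00 (enum_val j).
have E v w : (forall i, p i -> v i = w i) ->
    eval w t = eval (join_env (g v true) (g w false)) (subst s t).
  move=> vw; rewrite eval_subst; congr eval; apply/funext => i /=.
  by rewrite /g; case pi: (p i) => /=; rewrite enum_rankK pi // vw.
have E00 : eval v00 t = eval (join_env (g v00 true) (g v00 false)) (subst s t).
  exact: E.
have E01 : eval v01 t = eval (join_env (g v00 true) (g v01 false)) (subst s t).
  by apply: E => i /asboolP[].
have E11 : eval v11 t = eval (join_env (g v10 true) (g v01 false)) (subst s t).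
  rewrite (E v10 v11) => [|i /asboolP[] //].
  congr eval; congr join_env; apply/funext => j; rewrite /g; case: eqP => // pj.
  case: (sq (enum_val j)) => [/asboolP|[] //].
  by rewrite -/(p _) pj.
have E10 : eval v10 t = eval (join_env (g v10 true) (g v00 false)) (subst s t).
  rewrite (E v10 v10) => [|//].
  congr eval; congr join_env; apply/funext => j; rewrite /g; case: eqP => // pj.
  case: (sq (enum_val j)) => [/asboolP|[] //].
  by rewrite -/(p _) pj.
rewrite {}E00 {}E01 {}E10 {}E11; apply: C => j; rewrite /g; case: eqP => pj;
  try exact: crel_refl.
- by case/asboolP: pj.
- by case: (sq (enum_val j)) => [/asboolP|[] //]; rewrite -/(p _) pj.
Qed.

(** The two new values are [x]-related because [c] and [d] are; they are [y]-related because each is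
    [y]-related to the corresponding value in the premise. *)
Lemma centralizes_meet x y : centralizes y x (x `&` y)%O.
Proof.
move=> m n t a b c d ab cd /cong_meetE[_ yacd]; apply/cong_meetE; split.
  by apply: crel_eval => -[i|j] /=; [apply: crel_refl|apply: cd].
have yab e : y (eval (join_env a e) t) (eval (join_env b e) t).
  by apply: crel_eval => -[i|j] /=; [apply: ab|apply: crel_refl].
by apply: crel_trans (yab d); apply: crel_trans yacd; apply: crel_sym.
Qed.

Lemma centralizes_mono alpha beta alpha' beta' delta :
  (forall a b, alpha' a b -> alpha a b) ->
  (forall a b, beta' a b -> beta a b) ->
  centralizes alpha beta delta -> centralizes alpha' beta' delta.
Proof.
move=> sa sb C m n t a b c d ab cd.
by apply: C => [i|j]; [apply: sa|apply: sb].
Qed.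

(* The one-variable term condition; [centralizer_congruence] is the largest
   congruence centralizing beta modulo delta. *)
Definition centralizer_rel beta delta (a b : A) : Prop :=
  forall n (t : term S ('I_1 + 'I_n)) (c d : 'I_n -> A),
    (forall j, beta (c j) (d j)) ->
    delta (eval (join_env (fun=> a) c) t) (eval (join_env (fun=> a) d) t) <->
    delta (eval (join_env (fun=> b) c) t) (eval (join_env (fun=> b) d) t).

Lemma centralizer_rel_all beta delta m n (t : term S ('I_m + 'I_n))
    (a b : 'I_m -> A) (c d : 'I_n -> A) :
  (forall i, centralizer_rel beta delta (a i) (b i)) ->
  (forall j, beta (c j) (d j)) ->
  delta (eval (join_env a c) t) (eval (join_env a d) t) <->
  delta (eval (join_env b c) t) (eval (join_env b d) t).
Proof.
move=> ab cd.
(* The entries of [a] are exchanged for those of [b] one at a time; [h k] is the tuple after [k]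
   exchanges. *)
pose h k (i : 'I_m) := if (i < k)%N then b i else a i.
suff H k : delta (eval (join_env a c) t) (eval (join_env a d) t) <->
  delta (eval (join_env (h k) c) t) (eval (join_env (h k) d) t).
  have -> : b = h m by apply/funext => i; rewrite /h ltn_ord.
  exact: H.
elim: k => [|k IH]; first by have -> : h 0%N = a by apply/funext.
rewrite {}IH; case: (ltnP k m) => [km|mk]; last first.
  suff -> : h k.+1 = h k by [].
  apply/funext => i; rewrite /h !(leq_trans (ltn_ord i)) //; exact: leqW.
pose j0 := Ordinal km.
(* The entries other than [j0] become parameters on the right, where they stay fixed and are
   [beta]-related by reflexivity. *)
pose s (o : 'I_m + 'I_n) : term S ('I_1 + 'I_(m + n)) :=
  match o with
  | inl i => if i == j0 then Var _ (inl ord0) else Var _ (inr (lshift n i))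
  | inr j => Var _ (inr (rshift m j))
  end.
pose g e (i : 'I_(m + n)) := join_env (h k) e (split i).
have E u q e : u j0 = q -> (forall i, i != j0 -> u i = h k i) ->
    eval (join_env u e) t = eval (join_env (fun=> q) (g e)) (subst s t).
  move=> uq uh; rewrite eval_subst; congr eval; apply/funext => -[i|j] /=.
    case: eqP => [->//|/eqP ij] /=; rewrite /g.
    by rewrite -[lshift n i]/(unsplit (inl _ i)) unsplitK /= uh.
  by rewrite /g -[rshift m j]/(unsplit (inr _ j)) unsplitK.
have hS i : i != j0 -> h k.+1 i = h k i.
  by rewrite /h ltnS leq_eqVlt -val_eqE /= => /negbTE ->.
have h0 : h k j0 = a j0 by rewrite /h /= ltnn.
have h1 : h k.+1 j0 = b j0 by rewrite /h /= ltnSn.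
rewrite !(E (h k) _ _ h0) // !(E (h k.+1) _ _ h1) //; apply: ab => i.
by rewrite /g; case: (split i) => j //=; apply: crel_refl.
Qed.

Definition centralizer_congruence beta delta : congruence A.
Proof.
exists (centralizer_rel beta delta).
- by [].
- by move=> a b ab n t c d cd; rewrite (ab n t c d cd).
- by move=> a b c ab bc n t u v uv; rewrite (ab n t u v uv) (bc n t u v uv).
- move=> f a b ab n t c d cd.
  pose s (o : 'I_1 + 'I_n) : term S ('I_(arity f) + 'I_n) :=
    match o with
    | inl _ => App (fun i => Var _ (inl i))
    | inr j => Var _ (inr j)
    end.
  have E u e : eval (join_env (fun=> op u) e) t
             = eval (join_env u e) (subst s t).
    by rewrite eval_subst; congr eval; apply/funext => -[].
  by rewrite !E; apply: centralizer_rel_all.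
Defined.

Lemma centralizes_centralizer alpha beta delta :
  centralizes alpha beta delta <->
  (forall a b, alpha a b -> centralizer_congruence beta delta a b).
Proof.
split=> [C a b ab n t c d cd|sub m n t a b c d ab cd H].
  by split; apply: C => // i; apply: crel_sym.
by rewrite -(centralizer_rel_all t (fun i => sub _ _ (ab i)) cd).
Qed.

(** Both congruences lie below the largest one that centralizes [beta] modulo [delta], hence so does
    their join. *)
Lemma centralizes_join alpha alpha' beta delta :
  centralizes alpha beta delta -> centralizes alpha' beta delta ->
  centralizes (alpha `|` alpha')%O beta delta.
Proof.
move=> /centralizes_centralizer H /centralizes_centralizer H'.
by apply/centralizes_centralizer => a b; apply; split; apply/asboolP.
Qed.

Lemma commutator_sub alpha beta delta a b :
  centralizes alpha beta delta -> commutator alpha beta a b -> delta a b.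
Proof. by move=> C; apply. Qed.

End Centralizer.

Lemma not_meet_semidistributive_abelian (S : signature)
    (V : algebra S -> Prop) :
  ~ meet_semidistributive V ->
  exists (A : algebra S) (alpha delta : congruence A) (a b : A),
    [/\ V A, centralizes alpha alpha delta,
        forall u v, delta u v -> alpha u v, alpha a b & ~ delta a b].
Proof.
apply: contra_notP => H A VA x y z xyz; apply: contrapT => ne.
case: H; exists A, (x `&` (y `|` z))%O, (x `&` y)%O.
have le : ((x `&` y : congruence A) <= x `&` (y `|` z))%O.
  by rewrite leI2 // leUl.
have [a [b [ab nab]]] : exists a b : A,
    (x `&` (y `|` z) : congruence A)%O a b /\ ~ (x `&` y : congruence A)%O a b.
  apply: contrapT => K; apply: ne; apply/eqP; rewrite eq_le le /=.
  apply/asboolP => a b ab; apply: contrapT => nab; apply: K; by exists a, b.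
exists a, b; split=> //; last exact/asboolP.
(* Since [y] and [z] have the same meet with [x], both centralize [x] modulo that one congruence. *)
have C : centralizes (y `|` z)%O x (x `&` y)%O.
  apply: centralizes_join; first exact: centralizes_meet.
  rewrite xyz; exact: centralizes_meet.
by apply: centralizes_mono C => u v /cong_meetE[].
Qed.

(** * Affine structure from a weak difference term *)

Section Affine.
Variables (S : signature) (A : algebra S).

(* On blocks of alpha and modulo E, the term d is the ternary group operation
   x - y + z of an abelian group, and every term is an affine map. *)
Definition affine_modulo (alpha : congruence A) (E : A -> A -> Prop)
    (d : term S 'I_3) : Prop :=
  [/\ forall a b, alpha a b -> E (apply3 d a b b) a,
      forall a b, alpha a b -> E (apply3 d a a b) b &
      forall k (t : term S 'I_k) (u v w : 'I_k -> A),
        (forall i, alpha (u i) (v i)) -> (forall i, alpha (v i) (w i)) ->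
        E (eval (fun i => apply3 d (u i) (v i) (w i)) t)
          (apply3 d (eval u t) (eval v t) (eval w t))].

(** The commutator of [alpha] with itself lies below [delta], which gives the first two laws;
    commutation of [d] with terms takes one use of the term condition. *)
Lemma weak_difference_affine (alpha delta : congruence A) (d : term S 'I_3) :
  centralizes alpha alpha delta -> (forall a b, delta a b -> alpha a b) ->
  is_weak_difference_term A d -> affine_modulo alpha delta d.
Proof.
move=> C sub wd.
have d1 a b : alpha a b -> delta (apply3 d a b b) a.
  move=> ab; apply: crel_sym; apply: commutator_sub C _.
  by have [] := wd _ _ _ ab.
have d2 a b : alpha a b -> delta (apply3 d a a b) b.
  by move=> ab; apply: commutator_sub C _; have [] := wd _ _ _ ab.
split=> // k t u v w uv vw.
(* T is d(t(d(x, y, z)), d(t(x), t(y), t(z)), q): it equals q modulo delta at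
   (v, v, v), (v, v, w) and (u, v, v), so the term condition gives the same
   at (u, v, w); q is then chosen to be the second argument. *)
pose G : term S (option ('I_k * 'I_3)) :=
  subst (fun i => subst (fun j => Var _ (Some (i, j))) d) t.
pose H : term S (option ('I_k * 'I_3)) :=
  subst (fun j => subst (fun i => Var _ (Some (i, j))) t) d.
pose T := subst (tnth [tuple G; H; Var _ None]) d.
pose env (q : A) (x y z : 'I_k -> A) (o : option ('I_k * 'I_3)) : A :=
  if o is Some (i, j) then tnth [tuple x i; y i; z i] j else q.
have eG q x y z : eval (env q x y z) G
    = eval (fun i => apply3 d (x i) (y i) (z i)) t.
  rewrite eval_subst; congr eval; apply/funext => i.
  by rewrite eval_subst.
have eH q x y z : eval (env q x y z) H
    = apply3 d (eval x t) (eval y t) (eval z t).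
  rewrite eval_subst eval_apply3 !eval_subst /=.
  by congr apply3; congr eval; apply/funext => i;
    rewrite (tnth_nth q) //= inordK.
have eT q x y z : eval (env q x y z) T = apply3 d
     (eval (fun i => apply3 d (x i) (y i) (z i)) t)
     (apply3 d (eval x t) (eval y t) (eval z t)) q.
  rewrite eval_subst eval_apply3 -(eG q) -(eH q) !(tnth_nth G) /=.
  by rewrite inordK.
have uu i : alpha (u i) (u i) by apply: crel_refl.
have vv i : alpha (v i) (v i) by apply: crel_refl.
have vu i : alpha (v i) (u i) by apply: crel_sym.
have wv i : alpha (w i) (v i) by apply: crel_sym.
set q := apply3 d (eval u t) (eval v t) (eval w t).
have qv : alpha q (eval v t).
  apply: (@crel_trans _ _ _ _ (apply3 d (eval v t) (eval v t) (eval v t))).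
    by apply: crel_apply3; apply: crel_eval.
  by apply: sub; apply: d1; apply: crel_refl.
have Eq x y z s : delta (eval (fun i => apply3 d (x i) (y i) (z i)) t) s ->
    delta (apply3 d (eval x t) (eval y t) (eval z t)) s ->
    alpha s q -> delta (eval (env q x y z) T) q.
  move=> Gs Hs sq; rewrite eT; apply: crel_trans (d2 _ _ sq).
  by apply: crel_apply3 => //; apply: crel_refl.
have Eyz z : (forall i, alpha (z i) (v i)) -> delta (eval (env q v v z) T) q.
  move=> zv; have vz i : alpha (v i) (z i) by apply: crel_sym.
  apply: (Eq v v z (eval z t)).
  - by apply: crel_eval => i; apply: d2.
  - by apply: d2; apply: crel_eval.
  - by apply: crel_trans (crel_sym qv); apply: crel_eval.
have Exyy : delta (eval (env q u v v) T) q.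
  apply: (Eq u v v (eval u t)).
  - by apply: crel_eval => i; apply: d1.
  - by apply: d1; apply: crel_eval.
  - by apply: crel_trans (crel_sym qv); apply: crel_eval.
have Exyz : delta (eval (env q u v w) T) q.
  apply: crel_trans Exyy; apply: crel_sym.
  apply: (centralizes_square (v00 := env q v v v) (v01 := env q v v w) C).
    case=> [[i [[|[|[|//]]] Hj]]|]; rewrite /env ?(tnth_nth q) /=.
    - by left.
    - by left.
    - by right; split=> //; apply: crel_sym.
    - by left; split=> //; apply: crel_refl.
  by apply: (crel_trans (Eyz _ vv)); apply: crel_sym; apply: Eyz.
(* At [(u, v, w)] the value of [T] is d(g, q, q), where g is the value of [G], and this is g modulo
   [delta]. It remains to see that g and [q] are [alpha]-related, both being related to
   [eval v t]. *)
apply: crel_trans Exyz; rewrite eT -/q; apply: crel_sym; apply: (d1).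
apply: (@crel_trans _ _ _ _ (eval v t)); last exact: crel_sym.
apply: crel_eval => i.
apply: (@crel_trans _ _ _ _ (apply3 d (v i) (v i) (v i))).
  exact: crel_apply3.
by apply: sub; apply: d1.
Qed.

End Affine.

(** * Quotient algebras *)

Section Quotient.
Variables (S : signature) (A : algebra S) (delta : congruence A).

(** Classes are predicates, so by extensionality related elements have Leibniz equal classes, and
    identities can be stated with plain equality. *)
Definition quotient_carrier := {P : A -> Prop | exists a, P = delta a}.

Definition quotient_class (a : A) : quotient_carrier :=
  exist _ (crel delta a) (ex_intro _ a erefl).

Definition quotient_algebra : algebra S :=
  @Algebra S quotient_carrier
    (fun f v => quotient_class (op (fun i => sval (cid (svalP (v i))))))
    (let: inhabits a := carrier_inhabited A in inhabits (quotient_class a)).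

Definition quotient_proj (a : A) : quotient_algebra := quotient_class a.

Definition quotient_repr (q : quotient_algebra) : A := sval (cid (svalP q)).

Lemma quotient_proj_eq a b : quotient_proj a = quotient_proj b <-> delta a b.
Proof.
split=> [[E]|ab]; first by rewrite E; apply: crel_refl.
apply: eq_exist; apply/funext => c; apply/propext; split=> H.
  by apply: crel_trans H; apply: crel_sym.
exact: crel_trans H.
Qed.

Lemma quotient_reprK : cancel quotient_repr quotient_proj.
Proof.
move=> q; rewrite /quotient_repr.
case: (cid _) => a /=; case: q => P HP /= E; exact/eq_exist/esym.
Qed.

Lemma quotient_proj_op f (a : 'I_(arity f) -> A) :
  quotient_proj (op a) = op (quotient_proj \o a).
Proof.
apply/quotient_proj_eq; apply: crel_op => i.
by apply/quotient_proj_eq; rewrite quotient_reprK.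
Qed.

Lemma quotient_variety (V : algebra S -> Prop) :
  is_variety V -> V A -> V quotient_algebra.
Proof.
move=> [E VE] /VE H; apply/VE => s t /H st v.
have -> : v = quotient_proj \o (quotient_repr \o v).
  by apply/funext => x /=; rewrite quotient_reprK.
by rewrite -!(eval_hom quotient_proj_op) st.
Qed.

Variables (alpha : congruence A).
Hypothesis delta_sub : forall a b, delta a b -> alpha a b.

(** Chosen representatives serve here because [delta] lies below [alpha]: another choice changes
    them only within an [alpha]-block. *)
Definition quotient_congruence : congruence quotient_algebra.
Proof.
exists (fun q r => alpha (quotient_repr q) (quotient_repr r)).
- by move=> q; apply: crel_refl.
- by move=> q r; apply: crel_sym.
- by move=> q r s; apply: crel_trans.
- move=> f u v uv /=.
  have H c : alpha (quotient_repr (quotient_proj c)) c.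
    by apply: delta_sub; apply/quotient_proj_eq; rewrite quotient_reprK.
  apply: crel_trans (H _) _; apply: crel_trans (crel_sym (H _)).
  exact: crel_op.
Defined.

Lemma quotient_congruenceE a b :
  quotient_congruence (quotient_proj a) (quotient_proj b) <-> alpha a b.
Proof.
have H c : alpha (quotient_repr (quotient_proj c)) c.
  by apply: delta_sub; apply/quotient_proj_eq; rewrite quotient_reprK.
split=> [/= K|ab] /=.
  by apply: crel_trans (H _); apply: crel_trans K; apply: crel_sym.
by apply: crel_trans (H _) _; apply: crel_trans (crel_sym (H _)).
Qed.

Lemma quotient_affine (d : term S 'I_3) :
  affine_modulo alpha delta d -> affine_modulo quotient_congruence eq d.
Proof.
move=> [d1 d2 d3]; have hom := apply3_hom quotient_proj_op d.
split=> [a b ab|a b ab|k t u v w uv vw].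
- rewrite -(quotient_reprK a) -(quotient_reprK b) -hom.
  by apply/quotient_proj_eq; apply: d1.
- rewrite -(quotient_reprK a) -(quotient_reprK b) -hom.
  by apply/quotient_proj_eq; apply: d2.
have E (x : 'I_k -> quotient_algebra) :
    x = quotient_proj \o (quotient_repr \o x).
  by apply/funext => i /=; rewrite quotient_reprK.
rewrite (E u) (E v) (E w) -!(eval_hom quotient_proj_op) -hom.
have -> : (fun i => apply3 d ((quotient_proj \o (quotient_repr \o u)) i)
    ((quotient_proj \o (quotient_repr \o v)) i)
    ((quotient_proj \o (quotient_repr \o w)) i)) =
    quotient_proj \o (fun i => apply3 d (quotient_repr (u i))
      (quotient_repr (v i)) (quotient_repr (w i))).
  by apply/funext => i /=; rewrite hom.
rewrite -(eval_hom quotient_proj_op).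
by apply/quotient_proj_eq; apply: d3.
Qed.

End Quotient.

(** Preserving [u - v + w] rather than sums leaves the origin of the block unchosen. *)
Definition affine_in_block (S : signature) (d : term S 'I_3) (A : algebra S)
    (alpha : congruence A) (W : zmodType) (h : W -> A) : Prop :=
  (forall u v, alpha (h u) (h v)) /\
  forall u v w, h (u - v + w)%R = apply3 d (h u) (h v) (h w).

(** * Blocks as abelian groups *)

Section Block.
Variables (S : signature) (A : algebra S) (alpha : congruence A).
Variable d : term S 'I_3.
Hypothesis dP : affine_modulo alpha eq d.

Let dxyy a b : alpha a b -> apply3 d a b b = a.
Proof. by case: dP => H _ _; apply: H. Qed.

Let dxxy a b : alpha a b -> apply3 d a a b = b.
Proof. by case: dP => _ H _; apply: H. Qed.

Lemma affine_apply3_block e a b c :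
  alpha e a -> alpha e b -> alpha e c -> alpha e (apply3 d a b c).
Proof.
move=> ea eb ec; rewrite -[X in alpha X _](@dxyy e e); last exact: crel_refl.
exact: crel_apply3.
Qed.

(** This is commutation of [d] with terms, applied to [d] itself. *)
Lemma affine_medial e a1 b1 c1 a2 b2 c2 a3 b3 c3 :
  alpha e a1 -> alpha e b1 -> alpha e c1 ->
  alpha e a2 -> alpha e b2 -> alpha e c2 ->
  alpha e a3 -> alpha e b3 -> alpha e c3 ->
  apply3 d (apply3 d a1 b1 c1) (apply3 d a2 b2 c2) (apply3 d a3 b3 c3) =
  apply3 d (apply3 d a1 a2 a3) (apply3 d b1 b2 b3) (apply3 d c1 c2 c3).
Proof.
case: dP => _ _ H; move=> A1 B1 C1 A2 B2 C2 A3 B3 C3.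
have := H 3 d (tnth [tuple a1; a2; a3]) (tnth [tuple b1; b2; b3])
  (tnth [tuple c1; c2; c3]).
rewrite eval_apply3 !(tnth_nth a1) /= inordK //= => ->; first by [].
- by case=> [[|[|[|//]]] Hi]; rewrite !(tnth_nth e) /=;
    apply: (@crel_trans _ _ _ _ e) => //; apply: crel_sym.
- by case=> [[|[|[|//]]] Hi]; rewrite !(tnth_nth e) /=;
    apply: (@crel_trans _ _ _ _ e) => //; apply: crel_sym.
Qed.

Local Open Scope ring_scope.

Lemma block_group (e : A) : exists (G : zmodType) (i : G -> A),
  [/\ i 0 = e, injective i, affine_in_block d alpha i &
      forall a, alpha e a -> exists g, i g = a].
Proof.
pose T := {a | alpha e a}.
have ee : alpha e e by apply: crel_refl.
have dT a b c : alpha e a -> alpha e b -> alpha e c -> alpha e (apply3 d a b c).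
  exact: affine_apply3_block.
pose zero : T := exist _ e ee.
(* With origin [e], the sum is d(x, e, y) and the negative is d(e, x, e). The group laws are medial
   laws for 3 by 3 arrays in which the remaining entries are [e]. *)
pose add (x y : T) : T := exist _ _ (dT _ _ _ (svalP x) ee (svalP y)).
pose opp (x : T) : T := exist _ _ (dT _ _ _ ee (svalP x) ee).
have dl x : alpha e x -> apply3 d x e e = x.
  by move=> ex; apply: dxyy; apply: crel_sym.
have dr x : alpha e x -> apply3 d e e x = x by apply: dxxy.
have addA : associative add.
  move=> [x ex] [y ey] [z ez]; apply: eq_exist => /=.
  have := @affine_medial e x e e e e e y e z ex ee ee ee ee ee ey ee ez.
  by rewrite !dl ?dr.
have addC : commutative add.
  move=> [x ex] [y ey]; apply: eq_exist => /=.
  have := @affine_medial e e e x e e e y e e ee ee ex ee ee ee ey ee ee.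
  by rewrite !dl ?dr.
have add0 : left_id zero add by move=> [x ex]; apply: eq_exist => /=; apply: dr.
have addN : left_inverse zero opp add.
  move=> [x ex]; apply: eq_exist => /=.
  have := @affine_medial e e x e e e e e e x ee ex ee ee ee ee ee ee ex.
  by rewrite !dl ?dr // => ->; apply: dxyy.
pose cT : choiceType := HB.pack T (gen_eqMixin T) (gen_choiceMixin T).
pose G : zmodType := HB.pack (Choice.sort cT)
  (@GRing.isZmodule.Build cT zero opp add addA addC add0 addN).
exists G, (fun g : T => sval g); split=> //.
- by move=> [x ex] [y ey] /= xy; apply: (eq_exist ex ey xy).
- split=> [[x ex] [y ey]|[x ex] [y ey] [z ez]] /=.
    by apply: crel_trans ey; apply: crel_sym.
  have -> : apply3 d x e (apply3 d e y e) = apply3 d x y e.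
    have := @affine_medial e x e e e e e e y e ex ee ee ee ee ee ee ey ee.
    by rewrite !dl ?dr.
  have := @affine_medial e x y e e e e e e z ex ey ee ee ee ee ee ee ez.
  by rewrite !dl ?dr.
by move=> a ea; exists (exist _ a ea).
Qed.

End Block.

(** * Additive maps from prime fields to abelian groups *)

Section AbelianGroups.
Local Open Scope ring_scope.

(** For a prime p dividing n, either (n/p)x is nonzero and killed by p, or n/p is a smaller exponent
    killing x. *)
Lemma prime_order_element (G : zmodType) (x : G) n :
  (0 < n)%N -> x != 0 -> x *+ n = 0 ->
  exists p (y : G), [/\ prime p, y != 0 & y *+ p = 0].
Proof.
elim/ltn_ind: n x => n IH x n0 x0 xn.
have n1 : (1 < n)%N.
  case: n n0 xn {IH} => [//|[|//]] _; rewrite mulr1n => /eqP.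
  by rewrite (negbTE x0).
have [p0 pn] := (pdiv_gt0 n, pdiv_dvd n).
have := xn; rewrite -(divnK pn) mulrnA.
have [z|nz] := eqVneq (x *+ (n %/ pdiv n)) 0 => E.
  apply: (IH (n %/ pdiv n)%N _ x) => //.
    by rewrite ltn_Pdiv ?prime_gt1 ?pdiv_prime.
  by rewrite divn_gt0 // dvdn_leq.
by exists (pdiv n), (x *+ (n %/ pdiv n)); rewrite pdiv_prime.
Qed.

(** The multiple of [y] by a natural number depends only on that number modulo [p]. *)
Lemma Fp_additive (G : zmodType) p (y : G) :
  prime p -> y *+ p = 0 ->
  exists2 f : 'F_p -> G, {morph f : a b / a - b} & f 1 = y.
Proof.
move=> pp yp.
have ymod n : y *+ (n %% p) = y *+ n.
  by rewrite {2}(divn_eq n p) mulrnDr mulnC mulrnA yp mul0rn add0r.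
have D (a b : 'F_p) : y *+ (a + b)%R = y *+ a + y *+ b.
  have -> : nat_of_ord (a + b)%R = ((a + b) %% p)%N.
    by rewrite /=; congr (_ %% _)%N; apply: Fp_cast.
  by rewrite ymod mulrnDr.
exists (fun a : 'F_p => y *+ a) => [a b|].
  by apply/(addIr (y *+ b)); rewrite -D !subrK.
by rewrite /= modn_small ?mulr1n // Fp_cast // prime_gt1.
Qed.

(** The image of a fraction m/n is the solution z of nz = my: divisibility gives existence,
    torsion-freeness gives uniqueness. *)
Lemma rat_additive (G : zmodType) (y : G) :
  (forall n (x : G), (0 < n)%N -> x *+ n = 0 -> x = 0) ->
  (forall n (x : G), (0 < n)%N -> exists z, z *+ n = x) ->
  exists2 f : rat -> G, {morph f : a b / a - b} & f 1 = y.
Proof.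
move=> tf dv.
have tfz (m : int) (x z : G) : m != 0 -> x *~ m = z *~ m -> x = z.
  move=> m0 E; apply/eqP; rewrite -subr_eq0; apply/eqP.
  apply: (tf `|m|%N); first by rewrite absz_gt0.
  have : (x - z) *~ m = 0 by rewrite mulrzBl E subrr.
  case: (intP m) => [|k|k] //=.
  by rewrite mulrNz => /eqP; rewrite oppr_eq0 => /eqP.
have /choice[f fP] : forall q : rat, exists z : G, z *~ denq q = y *~ numq q.
  move=> q; have [|z zP] := dv `|denq q|%N (y *~ numq q).
    by rewrite absz_gt0 denq_neq0.
  by exists z; rewrite -zP -{1}absz_denq.
(* Any fraction for [q] determines the value, not only the reduced one, so additivity can be checked
   over a common denominator. *)
have fE q (m n : int) : n != 0 -> q = m%:~R / n%:~R -> f q *~ n = y *~ m.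
  move=> n0 E; apply: (tfz (denq q)); first exact: denq_neq0.
  rewrite -mulrzA mulrC mulrzA fP -!mulrzA; congr (_ *~ _).
  apply: (@intr_inj rat); rewrite !rmorphM /=.
  have -> : (numq q)%:~R = q * (denq q)%:~R :> rat.
    by rewrite -{2}[q]divq_num_den divfK // intr_eq0 denq_neq0.
  by rewrite mulrAC {1}E divfK ?intr_eq0.
exists f => [a b|].
  have da := denq_neq0 a; have db := denq_neq0 b.
  apply: (tfz (denq a * denq b)); first by rewrite mulf_neq0.
  rewrite mulrzBl (fE _ (numq a * denq b - numq b * denq a)) ?mulf_neq0 //.
    rewrite mulrzBr !mulrzA fP; congr (_ - _).
    by rewrite -fP -!mulrzA mulrC.
  rewrite -{1}[a]divq_num_den -{1}[b]divq_num_den intrB !intrM.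
  by rewrite -mulNr addf_div ?intr_eq0 // mulNr.
by have := fE 1 1 1 isT; rewrite divr1 !mulr1z; apply.
Qed.

End AbelianGroups.

(** * Affine lines over a prime field in a block *)

Section AffineLine.
Variables (S : signature) (d : term S 'I_3).
Local Open Scope ring_scope.

(** Separating [0] from [1] suffices for the lattice embedding: a functional can be scaled to take
    the value 1 at a vector outside a subspace on which it vanishes. *)
Definition has_affine_line (A : algebra S) (alpha : congruence A)
    (F : nzRingType) : Prop :=
  exists2 h : F -> A, affine_in_block d alpha h & h 1 <> h 0.

Lemma has_affine_line_additive (A : algebra S) (alpha : congruence A)
    (G : zmodType) (i : G -> A) (F : nzRingType) (f : F -> G) :
  injective i -> affine_in_block d alpha i ->
  {morph f : a b / a - b} -> f 1 != 0 -> has_affine_line alpha F.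
Proof.
move=> inj_i [ia iM] fB f1.
have f0 : f 0 = 0 by rewrite -[in LHS](subrr 0) fB subrr.
have fD a b : f (a + b) = f a + f b.
  by rewrite -{1}[b]opprK -[X in a - X]add0r !fB f0 add0r opprK.
exists (i \o f); first by split=> //= u v w; rewrite fD fB iM.
by move=> /= /inj_i /eqP; rewrite f0 (negbTE f1).
Qed.

Definition has_prime_affine_line (A : algebra S) (alpha : congruence A) :
    Prop :=
  has_affine_line alpha rat \/
  exists2 p, prime p & has_affine_line alpha 'F_p.

Lemma torsion_affine_line (A : algebra S) (alpha : congruence A)
    (G : zmodType) (i : G -> A) (x : G) n :
  injective i -> affine_in_block d alpha i ->
  (0 < n)%N -> x != 0 -> x *+ n = 0 -> has_prime_affine_line alpha.
Proof.
move=> inj_i ia n0 x0 /(prime_order_element n0 x0)[p [y [pp y0 yp]]].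
have [f fB f1] := Fp_additive pp yp.
right; exists p => //; apply: has_affine_line_additive inj_i ia fB _.
by rewrite f1.
Qed.

(** Passing from s to d(s, v, u) adds u - v. This expresses n-fold multiples by [d] alone, without
    an origin. *)
Lemma iter_apply3_block (A : algebra S) (G : zmodType) (i : G -> A) n x u v :
  (forall x y z, i (x - y + z) = apply3 d (i x) (i y) (i z)) ->
  iter n (fun s => apply3 d s (i v) (i u)) (i x) = i (x + (u - v) *+ n).
Proof.
move=> iM; elim: n => [|n IH]; first by rewrite mulr0n addr0.
by rewrite iterS IH -iM mulrSr [u - v]addrC !addrA.
Qed.

Section MultipleCongruence.
Variables (A : algebra S) (alpha : congruence A) (n : nat).
Hypothesis dP : affine_modulo alpha eq d.

(* b = a + n (u - v) in the group structure of the block of a. *)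
Definition multiple_rel (a b : A) : Prop :=
  exists u v, [/\ alpha a u, alpha a v &
    b = iter n (fun s => apply3 d s v u) a].

Lemma multiple_relP (G : zmodType) (i : G -> A) (x y : G) :
  injective i -> affine_in_block d alpha i ->
  (forall a, alpha (i 0) a -> exists g, i g = a) ->
  multiple_rel (i x) (i y) <-> exists z, y = x + z *+ n.
Proof.
move=> inj_i [ia iM] sur.
have it := iter_apply3_block n _ _ _ iM.
split=> [[u [v [xu xv]]]|[z ->]]; last first.
  by exists (i z), (i 0); split=> //; rewrite it subr0.
have [u' <-] := sur u (crel_trans (ia _ _) xu).
have [v' <-] := sur v (crel_trans (ia _ _) xv).
by rewrite it => /inj_i ->; exists (u' - v').
Qed.

Lemma multiple_rel_sub a b : multiple_rel a b -> alpha a b.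
Proof.
move=> [u [v [au av ->]]]; elim: n => [|k IH] /=; first exact: crel_refl.
exact: affine_apply3_block.
Qed.

(** This is the congruence n alpha. The equivalence laws are read off in the group of a block, where
    the class of x is the coset x + nG. *)
Definition multiple_congruence : congruence A.
Proof.
exists multiple_rel.
- move=> a; have [G [i [i0 inj_i iP sur]]] := block_group dP a.
  rewrite -i0 in sur *; apply/multiple_relP => //.
  by exists 0; rewrite mul0rn addr0.
- move=> a b ab; have [G [i [i0 inj_i iP sur]]] := block_group dP a.
  have [y yb] := sur b (multiple_rel_sub ab).
  rewrite -i0 -yb in sur ab *.
  have [z E] := (multiple_relP _ _ inj_i iP sur).1 ab.
  apply/multiple_relP => //.
  by exists (- z); rewrite E mulNrn addrK.
- move=> a b c ab bc; have [G [i [i0 inj_i iP sur]]] := block_group dP a.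
  have ab' := multiple_rel_sub ab.
  have [y yb] := sur b ab'.
  have [z zc] := sur c (crel_trans ab' (multiple_rel_sub bc)).
  rewrite -i0 -?yb -?zc in sur ab bc *.
  have [z1 E1] := (multiple_relP _ _ inj_i iP sur).1 ab.
  have [z2 E2] := (multiple_relP _ _ inj_i iP sur).1 bc.
  apply/multiple_relP => //.
  by exists (z1 + z2); rewrite E2 E1 mulrnDl addrA.
- move=> f a b ab.
  have /choice[u] : forall j, exists u, exists v,
      [/\ alpha (a j) u, alpha (a j) v &
          b j = iter n (fun s => apply3 d s v u) (a j)].
    by move=> j; apply: ab.
  move=> /choice[v uv].
  exists (op u), (op v); split; try by apply: crel_op => j; have [] := uv j.
  have -> : b = fun j => iter n (fun s => apply3 d s (v j) (u j)) (a j).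
    by apply/funext => j; have [] := uv j.
  (* Operations commute with [d], hence with repeated addition of a difference. *)
  suff H k : op (fun j => iter k (fun s => apply3 d s (v j) (u j)) (a j)) =
    iter k (fun s => apply3 d s (op v) (op u)) (op a) by apply: H.
  elim: k => [//|k IH]; rewrite iterS -IH.
  case: dP => _ _ dC.
  have := dC _ (App (fun j => Var S j))
    (fun j => iter k (fun s => apply3 d s (v j) (u j)) (a j)) v u.
  apply=> j; have [au av _] := uv j; last first.
    by apply: crel_trans au; apply: crel_sym.
  apply: (@crel_trans _ _ _ _ (a j)) => //; apply: crel_sym.
  by elim: k {IH} => [|k IH] /=; [apply: crel_refl|apply: affine_apply3_block].
Defined.

End MultipleCongruence.

Lemma exists_prime_affine_line (V : algebra S -> Prop) (A : algebra S)
    (alpha : congruence A) (a b : A) :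
  is_variety V -> V A -> affine_modulo alpha eq d -> alpha a b -> a <> b ->
  exists (A' : algebra S) (alpha' : congruence A'),
    [/\ V A', affine_modulo alpha' eq d & has_prime_affine_line alpha'].
Proof.
move=> varV VA dP ab nab.
(* If some n alpha with n > 0 is properly below [alpha], dividing by it produces torsion; otherwise
   every block is divisible. *)
have [[n [e [y [n0 ey ney]]]]|dv] := pselect (exists n e y,
    [/\ (0 < n)%N, alpha e y & ~ multiple_rel alpha n e y]).
  pose delta := multiple_congruence n dP.
  have dsub : forall u v, delta u v -> alpha u v.
    by move=> u v; apply: multiple_rel_sub.
  have dP' : affine_modulo (quotient_congruence dsub) eq d.
    apply: quotient_affine; case: (dP) => d1 d2 d3.
    split=> [u v uv|u v uv|k t u v w uv vw].
    - by rewrite d1 //; apply: crel_refl.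
    - by rewrite d2 //; apply: crel_refl.
    - by rewrite d3 //; apply: crel_refl.
  exists (quotient_algebra delta), (quotient_congruence dsub); split=> //.
    exact: quotient_variety.
  have [G [i [i0 inj_i iP sur]]] := block_group dP' (quotient_proj delta e).
  have [x xy] := sur _ ((quotient_congruenceE dsub e y).2 ey).
  apply: (torsion_affine_line (x := x) inj_i iP n0).
    apply/eqP => x0; apply: ney; apply: (quotient_proj_eq delta e y).1.
    by rewrite -xy x0 i0.
  (* With the class of [e] as origin, [x *+ n] is the class of e + n(y - e), which [delta]
     identifies with [e]. *)
  apply: inj_i; have := iter_apply3_block n 0 x 0 iP.2.
  rewrite subr0 add0r => <-; rewrite xy i0.
  have -> k : iter k (fun s => apply3 d s (quotient_proj delta e)
      (quotient_proj delta y)) (quotient_proj delta e) =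
      quotient_proj delta (iter k (fun s => apply3 d s e y) e).
    by elim: k => //= k ->; rewrite (apply3_hom (@quotient_proj_op _ _ delta)).
  apply/quotient_proj_eq; apply: crel_sym.
  by exists y, e; split=> //; apply: crel_refl.
exists A, alpha; split=> //.
have [G [i [i0 inj_i iP sur]]] := block_group dP a.
have [x xb] := sur b ab.
have x0 : x != 0 by apply/eqP => x0; apply: nab; rewrite -xb x0 i0.
(* Torsion in the divisible block gives a line over some ['F_p]; without torsion the map from [rat]
   exists. *)
have [[n [y [n0 y0 yn]]]|tf] := pselect (exists n (y : G),
    [/\ (0 < n)%N, y != 0 & y *+ n = 0]).
  exact: torsion_affine_line inj_i iP n0 y0 yn.
left; have [n y n0 yn|n y n0|f fB f1] := @rat_additive G x.
- by apply: contrapT => /eqP y0; apply: tf; exists n, y.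
- have : multiple_rel alpha n (i 0) (i y).
    apply: contrapT => ney; apply: dv; exists n, (i 0), (i y); split=> //.
    exact: iP.1.
  rewrite -i0 in sur.
  move=> /(multiple_relP n 0 y inj_i iP sur)[z]; rewrite add0r => ->.
  by exists z.
by apply: has_affine_line_additive inj_i iP fB _; rewrite f1.
Qed.

End AffineLine.

(** * The algebra of affine functions into blocks *)

Section AffineFunctions.
Variables (S : signature) (A : algebra S) (alpha : congruence A).
Variable d : term S 'I_3.
Hypothesis dP : affine_modulo alpha eq d.
Variable X : zmodType.
Local Open Scope ring_scope.

Lemma affine_in_block_op f (h : 'I_(arity f) -> X -> A) :
  (forall i, affine_in_block d alpha (h i)) ->
  affine_in_block d alpha (fun x => op (fun i => h i x)).
Proof.
move=> hP; split=> [u v|u v w].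
  by apply: crel_op => i; have [] := hP i.
case: dP => _ _ /(_ _ (App (fun i => Var S i))) /= <-.
- by congr op; apply/funext => i; have [_ ->] := hP i.
- by move=> i; have [] := hP i.
- by move=> i; have [] := hP i.
Qed.

Lemma affine_in_block_cst (a : A) : affine_in_block d alpha (fun _ : X => a).
Proof.
split=> [u v|u v w]; first exact: crel_refl.
by case: dP => [-> //]; apply: crel_refl.
Qed.

(** A subalgebra of the power of [A] with exponent [X]. Each member stays in one block, but
    different members may lie in different blocks. *)
Definition affine_functions : algebra S :=
  @Algebra S {h : X -> A | affine_in_block d alpha h}
    (fun f h => exist _ _ (affine_in_block_op (fun i => svalP (h i))))
    (let: inhabits a := carrier_inhabited A in
     inhabits (exist _ _ (affine_in_block_cst a))).

Lemma affine_functions_variety (V : algebra S -> Prop) :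
  is_variety V -> V A -> V affine_functions.
Proof.
move=> [E VE] /VE H; apply/VE => s t /H st v.
have ev r x : sval (eval v r) x = eval (fun n => sval (v n) x) r.
  exact: (@eval_hom _ affine_functions A (fun h => sval h x)).
have : sval (eval v s) = sval (eval v t) by apply/funext => x; rewrite !ev st.
by case: (eval v s) (eval v t) => [g gP] [h hP] /= gh; apply: eq_exist.
Qed.

Definition agreement_congruence (P : X -> Prop) : congruence affine_functions.
Proof.
exists (fun g h => forall x, P x -> sval g x = sval h x).
- by [].
- by move=> g h gh x /gh.
- by move=> g h k gh hk x Px; rewrite gh // hk.
- by move=> f g h gh x Px /=; congr op; apply/funext => i; apply: gh.
Defined.

(* The witness h(x) = g(Q x) - g(0) + g'(x - Q x) of permutability. *)
Lemma agreement_compose (P P' : X -> Prop) (Q : X -> X)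
    (g g' : affine_functions) :
  {morph Q : x y / x - y} -> P 0 -> P' 0 ->
  (forall x, P x -> P (x - Q x) /\ P' (x - Q x)) ->
  (forall x, P' x -> P (Q x) /\ P' (Q x)) ->
  (forall x, P x -> P' x -> sval g x = sval g' x) ->
  exists h : affine_functions,
    agreement_congruence P g h /\ agreement_congruence P' h g'.
Proof.
move=> QB P0 P'0 PQ P'Q gg'.
have Q0 : Q 0 = 0 by rewrite -[in LHS](subrr 0) QB subrr.
have QD x y : Q (x + y) = Q x + Q y.
  by rewrite -{1}[y]opprK -[X in x - X]add0r !QB Q0 add0r opprK.
case: (svalP g) => gb gM; case: (svalP g') => gb' gM'.
have g0 := gg' 0 P0 P'0.
have bl x y : alpha (sval g x) (sval g' y).
  by apply: crel_trans (gb x 0) _; rewrite g0.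
pose h x := apply3 d (sval g (Q x)) (sval g 0) (sval g' (x - Q x)).
have hP : affine_in_block d alpha h.
  split=> [u v|u v w]; first exact: crel_apply3.
  (* Expanding the three arguments of [d] gives a 3 by 3 array, which the medial law transposes. *)
  have -> : h (u - v + w) = apply3 d
      (apply3 d (sval g (Q u)) (sval g (Q v)) (sval g (Q w)))
      (apply3 d (sval g 0) (sval g 0) (sval g 0))
      (apply3 d (sval g' (u - Q u)) (sval g' (v - Q v)) (sval g' (w - Q w))).
    rewrite -!gM -gM' subrr add0r /h QD QB; congr (apply3 d _ _ (sval g' _)).
    by rewrite !(opprD, opprK) (addrACA _ w) (addrACA u).
  exact: (affine_medial dP (e := sval g 0)).
exists (exist _ h hP); split=> x /=; rewrite /h => Px.
  (* For x in [P], the point x - Q x lies in both sets, so g' may be replaced by g and the three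
     terms add up to g(x). On [P'] the same is done at Q x and at 0. *)
  have [Px1 Px2] := PQ x Px.
  by rewrite -(gg' _ Px1 Px2) -gM subr0 addrC subrK.
have [Px1 Px2] := P'Q x Px.
by rewrite (gg' _ Px1 Px2) g0 -gM' subr0 addrC subrK.
Qed.

End AffineFunctions.

(** * Projections, functionals and congruences of vector spaces *)

Section LinearAlgebra.
Local Open Scope ring_scope.
Variables (F : fieldType) (W : vectType F).

(** Project onto [U] along a complement of the intersection in [U']: a vector of [U'] loses only a
    component lying in [U']. *)
Lemma intersecting_projection (U U' : {vspace W}) : exists P : 'End(W),
  (forall u, u \in U -> P u = u) /\
  (forall u, u \in U' -> P u \in U /\ P u \in U').
Proof.
exists (addv_pi2 U' U); split=> u uU; first exact: addv_pi2_id.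
have E : u \in (U' + U)%VS.
  by rewrite memvE (subv_trans _ (addvSl _ _)) // -memvE.
split; first exact: memv_pi2.
rewrite -(addKr (addv_pi1 U' U u) (addv_pi2 U' U u)) addv_pi1_pi2 //.
rewrite rpredD ?rpredN //; apply: (subvP (diffvSl U' U)); exact: memv_pi.
Qed.

(** The component of [w] off [U] is nonzero, so some coordinate of it is; that coordinate, composed
    with the projection killing [U], is rescaled. *)
Lemma separating_functional (U : {vspace W}) (w : W) : w \notin U ->
  exists l : 'Hom(W, F^o), (forall u, u \in U -> l u = 0) /\ l w = 1.
Proof.
move=> wU; pose v := w - projv U w.
have v0 : v != 0.
  apply: contraNneq wU => /eqP; rewrite subr_eq0 => /eqP ->.
  exact: memv_proj.
pose f i : W -> F^o := coord (vbasis {:W}) i.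
have [i ci] : exists i, f i v != 0.
  apply: contrapT => H; move/eqP: v0; apply.
  rewrite (coord_vbasis (memvf v)) big1 // => i _.
  have [->|ci] := eqVneq (coord (vbasis {:W}) i v) 0; first exact: scale0r.
  by case: H; exists i.
pose l : 'Hom(W, F^o) := (f i v)^-1 *: (linfun (f i) \o (\1 - projv U))%VF.
have lE u : l u = (f i v)^-1 * f i (u - projv U u).
  by rewrite scale_lfunE comp_lfunE add_lfunE opp_lfunE id_lfunE lfunE.
exists l; split=> [u uU|]; rewrite lE.
  by rewrite projv_id // subrr /f linear0 mulr0.
by rewrite mulVf.
Qed.

(** Take [U] of largest dimension inside the class of 0. Adjoining any vector of that class keeps
    the span inside it, so by maximality [U] is the whole class. *)
Lemma congruence_subspace (x : congruence (vs_algebra W)) :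
  exists U : {vspace W}, forall u v, x u v <-> v - u \in U.
Proof.
have xD (a b c e : W) : x a b -> x c e -> x (a + c) (b + e).
  move=> ab ce; have := @crel_op _ _ x (VSadd F)
    (fun i => if i == ord0 then a else c) (fun i => if i == ord0 then b else e).
  by apply=> i; case: eqP.
have xZ (k a b : _) : x a b -> x (k *: a) (k *: b).
  by move=> ab; apply: (@crel_op _ _ x (VSscale k) (fun=> a) (fun=> b)).
have xB u v : x u v <-> x 0 (v - u).
  split=> H.
    by have := xD _ _ _ _ H (crel_refl x (- u)); rewrite subrr.
  by have := xD _ _ _ _ H (crel_refl x u); rewrite add0r subrK.
pose sub (U : {vspace W}) := forall u, u \in U -> x 0 u.
pose P n := `[< exists U, \dim U = n /\ sub U >].
have P0 : exists n, P n.
  exists 0%N; apply/asboolP; exists 0%VS; split; first exact: dimv0.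
  by move=> u; rewrite memv0 => /eqP ->; apply: crel_refl.
have Pb n : P n -> (n <= \dim {:W})%N.
  by move=> /asboolP[U [<- _]]; apply: dimvS; apply: subvf.
case: (ex_maxnP P0 Pb) => n /asboolP[U [dU sU]] nmax.
exists U => u v; rewrite xB; split=> [xuv|]; last exact: sU.
pose U' := (U + <[v - u]>)%VS.
have sU' : sub U'.
  move=> a /memv_addP[b bU [c /vlineP[k ->] ->]].
  by have := xD _ _ _ _ (sU b bU) (xZ k _ _ xuv); rewrite scaler0 addr0.
have /eqP E : (U == U')%VS.
  rewrite eqEdim addvSl dU /=; apply: nmax; apply/asboolP; by exists U'.
by rewrite E; apply: (subvP (addvSr U _)); apply: memv_line.
Qed.

(** A functional annihilating two congruences annihilates their join, because its kernel is a
    congruence above both. *)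
Lemma kernel_congruence (l : 'Hom(W, F^o)) :
  exists x : congruence (vs_algebra W), forall u v, x u v <-> l u = l v.
Proof.
unshelve eexists; first exists (fun u v : vs_algebra W => l u = l v) => //.
- by move=> a b c -> ->.
- case=> [|||c] a b ab /=; rewrite ?linearN ?linearD ?linearZ //=.
  + by rewrite ab.
  + by rewrite !ab.
  + by rewrite ab.
- by [].
Qed.

End LinearAlgebra.

(** * The embedding of the subspace lattice by annihilators *)

Section Embedding.
Variables (S : signature) (A : algebra S) (alpha : congruence A).
Variable d : term S 'I_3.
Hypothesis dP : affine_modulo alpha eq d.
Variables (F : fieldType) (W : vectType F).
Local Open Scope ring_scope.
Local Notation dual := 'Hom(W, F^o).

(** The annihilator, in the dual space, of the subspace belonging to [x]; stated through [x], it
    requires no choice of that subspace. *)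
Definition annihilates (x : congruence (vs_algebra W)) (l : dual) : Prop :=
  forall u v, x u v -> l u = l v.

(* Agreement on a subspace itself would reverse the order. *)
Definition subspace_congruence (x : congruence (vs_algebra W)) :
    congruence (affine_functions dP dual) :=
  agreement_congruence dP (annihilates x).

Lemma annihilatesP (x : congruence (vs_algebra W)) (U : {vspace W}) (l : dual) :
  (forall u v, x u v <-> v - u \in U) ->
  annihilates x l <-> forall u, u \in U -> l u = 0.
Proof.
move=> xU; split=> [H u uU|H u v /xU /H].
  by rewrite -(linear0 l); apply/esym/H/xU; rewrite subr0.
by rewrite linearB => /eqP; rewrite subr_eq0 => /eqP.
Qed.

Lemma annihilates0 x : annihilates x 0.
Proof. by move=> u v _; rewrite !zero_lfunE. Qed.

(** The annihilator of an intersection is the sum of the annihilators, and affine functions agreeing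
    on two subspaces agree on their sum. *)
Lemma subspace_congruence_meet :
  {morph subspace_congruence : x y / (x `&` y)%O}.
Proof.
move=> x y; apply: congruence_ext => g g'.
rewrite cong_meetE; split=> [H|[H H'] l xyl].
  by split=> l xl; apply: H => u v /cong_meetE[xuv yuv]; apply: xl.
have [U xU] := congruence_subspace x; have [U' yU'] := congruence_subspace y.
have [P [PU PU']] := intersecting_projection U U'.
have a1 : annihilates x (l - (l \o P)%VF).
  apply/(annihilatesP _ xU) => u uU.
  by rewrite add_lfunE opp_lfunE comp_lfunE PU // subrr.
have a2 : annihilates y (l \o P)%VF.
  apply/(annihilatesP _ yU') => u /PU'[u1 u2].
  rewrite comp_lfunE -(linear0 l); apply/esym/xyl/cong_meetE.
  by split; [apply/xU | apply/yU']; rewrite subr0.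
(* The sum is written in the ternary form that affine functions preserve. *)
have E : l = (l - (l \o P)%VF) - 0 + (l \o P)%VF by rewrite subr0 subrK.
rewrite E; case: (svalP g) (svalP g') => [_ ->] [_ ->].
by rewrite (H _ a1) (H' _ a2) (H _ (@annihilates0 x)).
Qed.

(** The annihilator of a join is the intersection of the annihilators. Functions agreeing there are
    linked by a single intermediate function, so the two agreement congruences permute. *)
Lemma subspace_congruence_join :
  {morph subspace_congruence : x y / (x `|` y)%O}.
Proof.
move=> x y; apply: le_anti; apply/andP; split; last first.
  have /asboolP lx := leUl x y; have /asboolP ly := leUr y x.
  rewrite leUx; apply/andP; split; apply/asboolP => g g' H l xyl;
    apply: H => u v uv; apply: xyl; by [apply: lx | apply: ly].
apply/asboolP => g g' H.
have [U xU] := congruence_subspace x; have [U' yU'] := congruence_subspace y.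
(* Unlike in the meet case, the projection is onto the subspace of [y]; composing functionals with
   it plays the role of [Q]. *)
have [P [PU' PU]] := intersecting_projection U' U.
have [|||l xl|l yl|l xl yl|h [gh hg']] := @agreement_compose _ _ _ _ dP dual
    (annihilates x) (annihilates y) (fun l => (l \o P)%VF) g g'.
- by move=> l l'; rewrite comp_lfunDl comp_lfunNl.
- exact: annihilates0.
- exact: annihilates0.
- have /(annihilatesP _ xU) xl0 := xl.
  split; [apply/(annihilatesP _ xU) => u uU|apply/(annihilatesP _ yU') => u uU];
    rewrite add_lfunE opp_lfunE comp_lfunE.
  + by have [_ Pu] := PU _ uU; rewrite !xl0 // subrr.
  + by rewrite PU' // subrr.
- have /(annihilatesP _ yU') yl0 := yl.
  split; [apply/(annihilatesP _ xU) => u uU|apply/(annihilatesP _ yU') => u uU];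
    rewrite comp_lfunE yl0 //.
  + by have [] := PU _ uU.
  + by rewrite PU'.
- apply: H => u v; have [z zP] := kernel_congruence l.
  move=> /(_ z) zuv; apply/zP/zuv.
  by split; apply/asboolP => a b ab; apply/zP; [apply: xl|apply: yl].
move=> z [/asboolP xz /asboolP yz].
by apply: crel_trans (xz _ _ gh) (yz _ _ hg').
Qed.

(** For a pair [(u, v)] in [x] but not in [y], evaluation at [v - u] followed by [phi] agrees with
    the constant [phi 0] on the annihilator of [x], yet differs from it at a functional annihilating
    [y]. *)
Lemma subspace_congruence_inj :
  has_affine_line d alpha F -> injective subspace_congruence.
Proof.
move=> [phi [phib phiM] phi10].
suff H x y u v :
    subspace_congruence x = subspace_congruence y -> x u v -> y u v.
  by move=> x y xy; apply: congruence_ext => u v; split; apply: H.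
move=> xy xuv; have [U' yU'] := congruence_subspace y.
apply/yU'; apply: contrapT => /negP /separating_functional[l [lU' l1]].
have phiP : affine_in_block d alpha (fun k : dual => phi (k (v - u))).
  split=> [k k'|k k' k'']; first exact: phib.
  by rewrite !add_lfunE opp_lfunE phiM.
pose g : affine_functions dP dual := exist _ _ phiP.
pose c : affine_functions dP dual :=
  exist _ _ (affine_in_block_cst dP dual (phi 0)).
have gc : subspace_congruence x g c.
  move=> k xk /=; congr phi; apply/eqP; rewrite linearB subr_eq0 eq_sym.
  exact/eqP/xk.
rewrite xy in gc; apply: phi10.
have /gc /= : annihilates y l by apply/(annihilatesP _ yU').
by rewrite l1.
Qed.

End Embedding.

(** * Transfer of sublattices from vector spaces to the variety *)

Lemma affine_line_SCon (S : signature) (V : algebra S -> Prop) (A : algebra S)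
    (alpha : congruence A) (d : term S 'I_3) (F : fieldType)
    (disp : Order.disp_t) (L : latticeType disp) :
  is_variety V -> V A ->
  affine_modulo alpha eq d -> has_affine_line d alpha F ->
  SCon (@fd_vector_spaces F) L -> SCon V L.
Proof.
move=> varV VA dP line [_ [W ->] [f [inj_f fI fU]]].
exists (affine_functions dP 'Hom(W, F^o)).
  exact: affine_functions_variety.
exists (subspace_congruence dP (W := W) \o f); split=> [|x y|x y] /=.
- by apply: inj_comp inj_f; apply: subspace_congruence_inj.
- by rewrite fI subspace_congruence_meet.
- by rewrite fU subspace_congruence_join.
Qed.

Theorem corollary6p3 (S : signature) (V : algebra S -> Prop) :
  is_variety V ->
  has_weak_difference_term V ->
  ~ meet_semidistributive V ->
  forall (d : Order.disp_t) (L : latticeType d), K_infty L -> SCon V L.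
Proof.
move=> varV [t wd] /not_meet_semidistributive_abelian.
move=> [A [alpha [delta [a [b [VA C sub ab nab]]]]]] d L [L0 Lp].
(* In the quotient by [delta] the affine laws hold with equality, and the classes of [a] and [b]
   stay distinct. The characteristic of the line obtained there selects which embedding of [L] is
   used. *)
have [| | |ne|A' [alpha' [VA' tP [line|[p pp line]]]]] :=
    @exists_prime_affine_line S t V (quotient_algebra delta)
    (quotient_congruence sub) (quotient_proj delta a) (quotient_proj delta b)
    varV.
- exact: quotient_variety.
- by apply: quotient_affine; apply: weak_difference_affine => //; apply: wd.
- exact/quotient_congruenceE.
- by apply: nab; apply/quotient_proj_eq.
- exact: affine_line_SCon tP line L0.
- exact: affine_line_SCon tP line (Lp p pp).
Qed.
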